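(* Let $X$ be a second countable locally compact topological space (not assumed Hausdorff). The following conditions are equivalent: (i) $X$ is a $\mathcal{C}\mathcal{R}$-space, i.e. $\gamma(X)$ is a second countable locally compact Hausdorff space; (ii) $\gamma(X)$ is locally compact; (iii) $\gamma(X)$ is first countable.
   Context: A topological space is called locally compact if every point has a neighbourhood base consisting of compact sets; neither ''compact'' nor ''locally compact'' includes the Hausdorff property. $C^b(X)$ denotes the algebra of all complex valued bounded continuous functions on $X$. Define an equivalence relation on $X$ by $x_1\sim x_2$ if $f(x_1)=f(x_2)$ for every $f\in C^b(X)$. Let $\gamma(X) := X/{\sim}$ with quotient map $q: X\to\gamma(X)$. The space $\gamma(X)$ carries the quotient topology; for second countable locally compact $X$ (which is $\sigma$-compact) this coincides with the weak topology on $\gamma(X)$ defined by the functions of $C^b(X)$ viewed as functions on $\gamma(X)$. A second countable locally compact space $X$ is called a $\mathcal{C}\mathcal{R}$-space if $\gamma(X)$ is a second countable locally compact Hausdorff space. *)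

(* Defs.v *)
From HB Require Import structures.
From mathcomp Require Import all_boot all_order all_algebra.
From mathcomp Require Import all_classical all_reals all_analysis.
From mathcomp Require Import complex.

Set Implicit Arguments.
Unset Strict Implicit.
Unset Printing Implicit Defensive.

Import Order.TTheory GRing.Theory Num.Theory.
Import numFieldNormedType.Exports.

Local Open Scope classical_set_scope.
Local Open Scope ring_scope.
Local Open Scope complex_scope.

(* Not the library's [locally_compact setT], which asks each point for a single
   closed compact neighbourhood: without Hausdorffness the two notions differ. *)
Definition locally_compact_space (T : topologicalType) : Prop :=
  forall (x : T) (U : set T), nbhs x U ->
    exists K : set T, [/\ nbhs x K, compact K & K `<=` U].

Definition first_countable (T : topologicalType) : Prop :=
  forall x : T, exists B : set (set T),
    [/\ countable B, B `<=` nbhs x &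
        forall U : set T, nbhs x U -> exists2 V, B V & V `<=` U].

Section gamma.
Context (R : realType) (X : topologicalType).

(* [R[i]^o] is the complex field as a normed module over itself, hence with the
   topology of the modulus. *)
Definition Cb : set (X -> R[i]^o) := [set f | continuous f /\ bounded_fun f].

Definition Cb_eq (x1 x2 : X) : Prop := forall f, Cb f -> f x1 = f x2.

Definition Cb_rel : rel X := fun x1 x2 => `[< Cb_eq x1 x2 >].

Lemma Cb_rel_refl : reflexive Cb_rel.
Proof. by move=> x; apply/asboolP => f. Qed.

Lemma Cb_rel_sym : symmetric Cb_rel.
Proof. by move=> x y; apply/asbool_equiv_eq; split=> xy f /xy. Qed.

Lemma Cb_rel_trans : transitive Cb_rel.
Proof.
by move=> y x z /asboolP xy /asboolP yz; apply/asboolP => f Cf; rewrite xy ?yz.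
Qed.

Canonical Cb_equiv : equiv_rel X :=
  EquivRel Cb_rel Cb_rel_refl Cb_rel_sym Cb_rel_trans.

Definition gamma : topologicalType := quotient_topology {eq_quot Cb_equiv}%qT.

Definition CR_space : Prop :=
  [/\ @second_countable X, locally_compact_space X &
      [/\ @second_countable gamma, locally_compact_space gamma
        & hausdorff_space gamma]].

End gamma.

(* Main.v *)
(** Write X as an increasing union of compact sets K_n whose interiors cover X,
    so that gamma(X) carries the colimit topology of the compact sets q(K_n).
    It is Hausdorff because C^b(X) separates its points. A sequence y_n outside
    q(K_n) meets each q(K_m) finitely often, hence has no cluster point. Thus
    if a point has a compact neighbourhood or a countable neighbourhood base,
    one of the q(K_n) is a neighbourhood of it. Finally the q(K_n) are Hausdorff
    images of compact second countable spaces, hence second countable, and so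
    is gamma(X) as soon as their interiors cover it. *)
Require Import Defs.
From mathcomp Require Import all_boot all_order all_algebra.
From mathcomp Require Import all_classical all_reals all_analysis.
From mathcomp Require Import complex.

Set Implicit Arguments.
Unset Strict Implicit.
Unset Printing Implicit Defensive.

Import numFieldNormedType.Exports.

Local Open Scope classical_set_scope.

Lemma second_countable_seq (T : topologicalType) : @second_countable T ->
  exists b : nat -> set T, (forall n, open (b n)) /\
    forall (x : T) U, nbhs x U -> exists n, b n x /\ b n `<=` U.
Proof.
move=> [B cB [Bo Bb]]; have /pcard_geP[f] := cB.
(* [f] reaches all of [B] but may also take values outside it; interiors make every term open and
   leave members of [B] unchanged. *)
exists (fun n => (f n)°); split=> [n|x U /Bb[V /= [BV Vx] VU]].
  exact: open_interior.
have [n _ fn] : (f @` setT) V by exact: (@surj _ _ _ _ f V BV).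
have Vo := Bo V BV; exists n; rewrite fn.
by move/interior_id: Vo => ->.
Qed.

Lemma second_countable_first_countable (T : topologicalType) :
  @second_countable T -> first_countable T.
Proof.
move=> [B cB [Bo Bb]] x; exists [set U | B U /\ U x]; split.
- by apply: sub_countable cB; apply: subset_card_le => U [].
- by move=> U [/Bo oU Ux]; exact: open_nbhs_nbhs.
- by move=> U /Bb[V /= BV VU]; exists V.
Qed.

Lemma first_countable_seq (T : topologicalType) (x : T) : first_countable T ->
  exists V : nat -> set T, (forall n, nbhs x (V n)) /\
    forall U, nbhs x U -> \forall n \near \oo, V n `<=` U.
Proof.
move=> /(_ x)[B [cB Bx xB]]; have /pcard_geP[f] := cB.
(* Values outside [B] are replaced by [setT]; the finite intersections of the [g i] then decrease,
   so that inclusion in [U] persists for all later indices. *)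
pose g n : set T := if f n \in B then f n else setT.
exists (fun n => \bigcap_(i < n.+1) g i); split=> [n|U /xB[V BV VU]].
  rewrite bigcap_mkord; elim/big_ind : _ => [|A C|i _].
  - exact: filterT.
  - exact: filterI.
  - rewrite /g; case: ifPn => [|_]; last exact: filterT.
    by rewrite inE => /Bx.
have [n _ fn] : (f @` setT) V by exact: (@surj _ _ _ _ f V BV).
exists n => // m /= nm t /(_ n nm) gn; apply: VU.
by move: gn; rewrite /g fn mem_set.
Qed.

Lemma compact_exhaustion (T : topologicalType) :
  @second_countable T -> locally_compact_space T ->
  exists K : nat -> set T,
    [/\ forall n, compact (K n),
        forall m n, (m <= n)%N -> K m `<=` K n &
        forall x : T, exists n, nbhs x (K n)].
Proof.
move=> /second_countable_seq[b [bo bb]] lcT.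
(* [C n] contains [b n] as soon as some compact set does, and is empty otherwise. The basic sets of
   the first sort already cover [T]. *)
have /choice[C CP] : forall n, exists C : set T, compact C /\
    forall D, compact D -> b n `<=` D -> b n `<=` C.
  move=> n; have [[D [cD bD]]|nD] :=
    pselect (exists D, compact D /\ b n `<=` D); first by exists D.
  exists set0; split=> [|D cD bD]; first exact: compact0.
  by exfalso; apply: nD; exists D.
exists (fun n => \big[setU/set0]_(i < n) C i); split.
- by move=> n; apply: bigsetU_compact => i _; have [] := CP i.
- by move=> m n mn; exact/subset_bigsetU.
move=> x; have [D [xD cD _]] := lcT x _ (@filterT _ (nbhs x) _).
have [n [bx bD]] := bb x D xD; exists n.+1.
apply: (@filterS _ _ _ (b n)); last exact: open_nbhs_nbhs.
apply: subset_trans (proj2 (CP n) D cD bD) _.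
by rewrite big_ord_recr; exact: subsetUr.
Qed.

Lemma hausdorff_compact_nbhs (T : topologicalType) : hausdorff_space T ->
  (forall x : T, exists2 K, nbhs x K & compact K) -> locally_compact_space T.
Proof.
move=> hT cT x U xU; have [K xK cK] := cT x.
have [V xV VU] := compact_regular hT cK xK xU.
exists (K `&` closure V); split.
- by apply: filterI => //; apply: filterS xV; exact: subset_closure.
- by apply: compact_closedI => //; exact: closed_closure.
- by move=> t [_ /VU].
Qed.

Section quotient_of_exhausted_space.
Context (X Y : topologicalType) (q : X -> Y) (K : nat -> set X).
Hypothesis q_cont : continuous q.
Hypothesis q_surj : forall y, exists x, q x = y.
Hypothesis q_quot : forall A, open (q @^-1` A) -> open A.
Hypothesis hY : hausdorff_space Y.
Hypothesis K_compact : forall n, compact (K n).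
Hypothesis K_mono : forall m n, (m <= n)%N -> K m `<=` K n.
Hypothesis K_cover : forall x : X, exists n, nbhs x (K n).

Lemma image_compact (A : set X) : compact A -> compact (q @` A).
Proof. by apply: continuous_compact; exact: continuous_subspaceT. Qed.

(** The complement is tested for openness in [X]. On a neighbourhood [K n] of [x], only terms [y k]
    with [k < n] can be met, since q(K n) lies in q(K k) for [n <= k]; these finitely many points
    form a closed set. *)
Lemma closed_escaping (y : nat -> Y) (m : nat) :
  (forall n, ~ (q @` K n) (y n)) -> closed (y @` [set k | (m <= k)%N]).
Proof.
move=> yK; set S := y @` _.
rewrite -[S]setCK; apply/open_closedC/q_quot; rewrite openE => x /= Sx.
have [n xKn] := K_cover x.
pose F := S `&` (y @` `I_n).
have Fc : closed F.
  apply: (accessible_finite_set_closed.1 (hausdorff_accessible hY)).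
  by apply: finite_setIr; apply: finite_image; exact: finite_II.
have xF : nbhs x (q @^-1` ~` F).
  apply: q_cont; apply: open_nbhs_nbhs; split; first exact: closed_openC.
  by move=> [].
apply: filterS (filterI xKn xF) => t [Kt Ft] St; apply: Ft; split => //.
case: St => k /= mk ykt; exists k => //=; rewrite ltnNge; apply/negP => nk.
by apply: (yK k); exists t => //; exact: K_mono Kt.
Qed.

Lemma not_cluster_escaping (y : nat -> Y) (z : Y) :
  (forall n, ~ (q @` K n) (y n)) -> ~ cluster (y @ \oo) z.
Proof.
move=> yK cz; have [x qx] := q_surj z; have [n xKn] := K_cover x.
(* As [z] lies in q(K n), the tail from [n] on avoids it; the tail being closed, its complement is a
   neighbourhood of [z]. *)
pose S := y @` [set k | (n <= k)%N].
have nSz : (~` S) z.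
  move=> [k /= nk ykz]; apply: (yK k); exists x; last by rewrite ykz.
  exact: K_mono nk _ (nbhs_singleton xKn).
have yS : (y @ \oo) S by exists n => // k /= nk; exists k.
have zS : nbhs z (~` S).
  by apply: open_nbhs_nbhs; split => //; exact/closed_openC/closed_escaping.
by have [t []] := cz _ _ yS zS.
Qed.

Lemma compact_sub_image (C : set Y) : compact C ->
  exists n, C `<=` q @` K n.
Proof.
move=> cC; apply: contrapT => nC.
have /choice[y yP] : forall n, exists y, C y /\ ~ (q @` K n) y.
  move=> n; apply: contrapT => ny; apply: nC; exists n => t Ct.
  by apply: contrapT => nt; apply: ny; exists t.
have [|z [_]] := cC (y @ \oo) _; first by exists 0 => // n _; have [] := yP n.
by apply: not_cluster_escaping => n; have [] := yP n.
Qed.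

Lemma nbhs_image_of_first_countable (z : Y) : first_countable Y ->
  exists n, nbhs z (q @` K n).
Proof.
move=> /first_countable_seq-/(_ z)[V [zV Vz]]; apply: contrapT => nK.
have /choice[y yP] : forall n, exists y, V n y /\ ~ (q @` K n) y.
  move=> n; apply: contrapT => ny; apply: nK; exists n.
  apply: filterS (zV n) => t Vt.
  by apply: contrapT => nt; apply: ny; exists t.
have yK n : ~ (q @` K n) (y n) by have [] := yP n.
(* Since [y n] lies in [V n], the sequence converges to [z], which is thus a cluster point. *)
apply: (@not_cluster_escaping y z yK) => A B [m _ mA] zB.
have [k _ kB] := Vz B zB; exists (y (maxn m k)); split.
  exact/mA/leq_maxl.
by apply: (kB (maxn m k)); [exact: leq_maxr|have [] := yP (maxn m k)].
Qed.

Lemma second_countable_of_nbhs_image : @second_countable X ->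
  (forall z : Y, exists n, nbhs z (q @` K n)) -> @second_countable Y.
Proof.
move=> /second_countable_seq[b [bo bb]] Kz.
pose bU (s : seq nat) := \bigcup_(i in [set` s]) b i.
(* With U a finite union of basic sets, [W] consists of interior points of q(K n) whose preimages in
   [K n] all lie in U. It is open because q(K n \ U) is compact, hence closed. *)
pose W (p : nat * seq nat) := (q @` K p.1)° `\` (q @` (K p.1 `\` bU p.2)).
exists (range W); first exact: card_le_trans (card_image_le _ _) (countableP _).
split=> [_ [[n s] _ <-]|z U].
  rewrite /W setDE; apply: openI; first exact: open_interior.
  apply: closed_openC.
  apply: compact_closed => //; apply: image_compact => //.
  apply: compact_closedI => //; apply: open_closedC.
  by apply: bigcup_open.
rewrite nbhsE => -[G [oG Gz] GU]; have [n zK] := Kz z.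
have qG : open (q @^-1` G).
  by apply: open_comp => // x _; exact: q_cont.
(* These unions [bU (s m)] increase to the preimage of [G], so one of them contains the compact
   trace on [K n] of the fibre over [z]. *)
pose s m := [seq i <- iota 0 m | `[< b i `<=` q @^-1` G >]].
have : compact (K n `&` q @^-1` [set z]).
  apply: compact_closedI => //; apply: closed_comp => [x _|].
    exact: q_cont.
  exact/accessible_closed_set1/hausdorff_accessible.
move/compact_near_coveringP => /(_ nat \oo (fun m => bU (s m)) _)[].
  move=> x [_ /= qx].
  have [i [bx bG]] : exists i, b i x /\ b i `<=` q @^-1` G.
    by apply: bb; apply: open_nbhs_nbhs; split => //=; rewrite qx.
  exists (b i, [set m | (i < m)%N]).
    split; first by rewrite /=; apply: open_nbhs_nbhs; split.
    exact: nbhs_infty_gt.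
  move=> [t m] /= [bt im]; exists i => //=.
  by rewrite mem_filter mem_iota im asboolT.
move=> m _ /(_ m (leqnn m)) Km; exists (W (n, s m)) => /=.
  split; first by exists (n, s m).
  by split=> // -[x [Kx nbx] qx]; apply: nbx; exact: Km.
apply: subset_trans GU => t [/interior_subset [x Kx <-] nx].
have [i /= +] : bU (s m) x by apply: contrapT => bx; apply: nx; exists x.
by rewrite mem_filter => /andP[/asboolP bG _] /bG.
Qed.

End quotient_of_exhausted_space.

Lemma gamma_hausdorff (R : realType) (X : topologicalType) :
  hausdorff_space (gamma R X).
Proof.
move=> y z yz; apply: contrapT => /eqP ynz.
have : ~ Cb_eq R (repr y) (repr z).
  move=> /asboolP yz'; move/eqP: ynz; apply.
  by rewrite -[y]reprK -[z]reprK; apply/eqmodP.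
move=> /existsNP[f /not_implyP[Cf]]; apply.
have [fc _] := Cf.
(* [f] is constant on classes, so it descends to a continuous map into the Hausdorff space of
   complex numbers, where the images of [y] and [z] differ. *)
have rc : continuous (f \o repr : gamma R X -> (R[i]^o)%type).
  apply: repr_comp_continuous => // a b /eqP/eqmodP/asboolP ab.
  exact/eqP/ab.
apply: (@norm_hausdorff _ R[i]^o) => A B /rc yA /rc zB.
by have [t [At Bt]] := yz _ _ yA zB; exists (f (repr t)).
Qed.

Theorem theorem3p3 (R : realType) (X : topologicalType)
    (X_second_countable : @second_countable X)
    (X_locally_compact : locally_compact_space X) :
  [<-> CR_space R X;
       locally_compact_space (gamma R X);
       first_countable (gamma R X)].
Proof.
have [K [Kc Km Kx]] := compact_exhaustion X_second_countable X_locally_compact.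
pose q : X -> gamma R X := \pi_(gamma R X)%qT.
have qc : continuous q by exact: pi_continuous.
have qs y : exists x, q x = y by exists (repr y); exact: reprK.
have qq A : open (q @^-1` A) -> open A by [].
have hG := @gamma_hausdorff R X.
tfae.
- by case=> _ _ [].
- move=> lcG; apply: second_countable_first_countable.
  apply: (second_countable_of_nbhs_image qc hG Kc) => // z.
  have [C [zC cC _]] := lcG z _ (@filterT _ (nbhs z) _).
  have [n Cn] := compact_sub_image qc qs qq hG Km Kx cC.
  by exists n; exact: filterS zC.
- move=> fG.
  have Kz (z : gamma R X) : exists n, nbhs z (q @` K n).
    exact: nbhs_image_of_first_countable qc qs qq hG Km Kx z fG.
  split=> //; split=> //.
    exact: (second_countable_of_nbhs_image qc hG Kc).
  (* In a Hausdorff space one compact neighbourhood per point suffices, and q(K n) is one. *)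
  apply: hausdorff_compact_nbhs => // z; have [n zn] := Kz z.
  by exists (q @` K n) => //; exact: image_compact.
Qed.
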